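(* Let $G$ be a nontrivial finitely generated orderable group. Then $G$ has a discrete right order. If moreover $G$ has a central order, then $G$ has a discrete lexicographic right order.
   Context: A right order on a group $G$ is a strict total order $<$ on the set $G$ such that $f<g$ implies $fh<gh$ for all $f,g,h\in G$; it is an order if in addition $f<g$ implies $hf<hg$, and $G$ is orderable if it admits an order. A right order is discrete if there is an element $a>1$ such that no element of $G$ lies strictly between $1$ and $a$. A subset $X$ of $G$ is convex if $x<y<z$ and $x,z\in X$ imply $y\in X$. A convex jump $C\rightarrowtail D$ is a pair of distinct convex subgroups $C\subset D$ with no convex subgroup strictly between them. An order on $G$ is central if for every convex jump $C\rightarrowtail D$ we have $[D,G]\subseteq C$, where $[D,G]=\langle d^{-1}g^{-1}dg\mid d\in D,\ g\in G\rangle$. A series for $G$ is a set $\Sigma=\{H_\lambda\mid\lambda\in\Lambda\}$ of subgroups, with $\Lambda$ totally ordered, such that $\lambda<\mu$ implies $H_\lambda\subset H_\mu$; $\{1\},G\in\Sigma$; $\Sigma$ is closed under arbitrary unions and intersections; and whenever $\mu$ immediately follows $\lambda$ in $\Lambda$, $H_\lambda$ is normal in $H_\mu$, with $H_\mu/H_\lambda$ then called a factor. A right order on $G$ is lexicographic if its convex subgroups form a series whose factors (with the induced order) are order isomorphic to subgroups of the additive group of reals. *)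

(* Defs.v *)
From mathcomp Require Import all_boot all_order all_algebra.
From mathcomp Require Import all_classical all_reals.

Set Implicit Arguments.
Unset Strict Implicit.
Unset Printing Implicit Defensive.

Import Order.TTheory GRing.Theory Num.Theory.

Local Open Scope classical_set_scope.
Local Open Scope group_scope.

Section Groups.
Variable G : groupType.
Implicit Types H K A B X : set G.

Definition subgroup H : Prop :=
  [/\ H 1, forall x y, H x -> H y -> H (x * y) & forall x, H x -> H x^-1].

Definition generated X : set G :=
  \bigcap_(H in [set H | subgroup H /\ X `<=` H]) H.

Definition finitely_generated : Prop :=
  exists X : set G, finite_set X /\ generated X = [set: G].

Definition nontrivial : Prop := exists g : G, g <> 1.

(* [~ x, y] is x^-1 * y^-1 * x * y. *)
Definition commutator_subgroup A B : set G :=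
  generated [set [~ a, b] | a in A & b in B].

(* Normality of K in H; K `<=` H is not part of the definition. *)
Definition normal_in K H : Prop := forall k h, K k -> H h -> K (k ^ h).

Definition right_coset K x : set G := [set k * x | k in K].

Definition set_product A B : set G := [set a * b | a in A & b in B].

(* The quotient H / K as a set of cosets, with multiplication set_product. *)
Definition quotient_group H K : set (set G) := [set right_coset K h | h in H].

End Groups.

Section RightOrders.
Variable G : groupType.
Variable lt : G -> G -> Prop.
Implicit Types C D H K X Y : set G.

Definition strict_total_order : Prop :=
  [/\ forall x, ~ lt x x,
      forall x y z, lt x y -> lt y z -> lt x z &
      forall x y, x <> y -> lt x y \/ lt y x].

Definition right_order : Prop :=
  strict_total_order /\ forall f g h, lt f g -> lt (f * h) (g * h).

Definition bi_order : Prop :=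
  right_order /\ forall f g h, lt f g -> lt (h * f) (h * g).

Definition discrete : Prop :=
  exists a, lt 1 a /\ ~ exists x, lt 1 x /\ lt x a.

Definition convex X : Prop :=
  forall x y z, lt x y -> lt y z -> X x -> X z -> X y.

Definition convex_subgroups : set (set G) :=
  [set H | subgroup H /\ convex H].

End RightOrders.

(* D immediately follows C in the set of subgroups Sigma, ordered by inclusion. *)
Definition jump (G : groupType) (Sigma : set (set G)) (C D : set G) : Prop :=
  [/\ Sigma C, Sigma D, C `<` D &
      ~ exists E, [/\ Sigma E, C `<` E & E `<` D]].

Definition convex_jump (G : groupType) (lt : G -> G -> Prop) (C D : set G) :
  Prop := jump (convex_subgroups lt) C D.

Definition central (G : groupType) (lt : G -> G -> Prop) : Prop :=
  forall C D, convex_jump lt C D -> commutator_subgroup D [set: G] `<=` C.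

(* A series is indexed by its own members, ordered by inclusion.  Unions are
   taken over nonempty subfamilies: the empty union is not a subgroup, and the
   empty intersection is the whole group. *)
Definition series (G : groupType) (Sigma : set (set G)) : Prop :=
  [/\ Sigma `<=` @subgroup G,
      total_on Sigma subset,
      Sigma [set 1] /\ Sigma [set: G],
      forall F : set (set G), F `<=` Sigma -> F !=set0 ->
        Sigma (\bigcup_(H in F) H) /\ Sigma (\bigcap_(H in F) H) &
      forall K H, jump Sigma K H -> normal_in K H].

(* The order induced by lt on the cosets of a convex subgroup. *)
Definition coset_lt (G : groupType) (lt : G -> G -> Prop) (X Y : set G) :
  Prop := forall x y, X x -> Y y -> lt x y.

Definition additive_subgroup (R : realType) (A : set R) : Prop :=
  [/\ A 0%R, forall x y, A x -> A y -> A (x + y)%R &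
      forall x, A x -> A (- x)%R].

(* H / K, with the order induced by lt, is isomorphic as an ordered group to
   a subgroup of the additive group of R. *)
Definition factor_order_isomorphic (R : realType) (G : groupType)
    (lt : G -> G -> Prop) (H K : set G) : Prop :=
  exists (A : set R) (phi : set G -> R),
    [/\ additive_subgroup A,
        set_bij (quotient_group H K) A phi,
        forall X Y, quotient_group H K X -> quotient_group H K Y ->
          phi (set_product X Y) = (phi X + phi Y)%R &
        forall X Y, quotient_group H K X -> quotient_group H K Y ->
          coset_lt lt X Y <-> (phi X < phi Y)%R].

Definition lexicographic (R : realType) (G : groupType)
    (lt : G -> G -> Prop) : Prop :=
  [/\ right_order lt,
      series (convex_subgroups lt) &
      forall K H, jump (convex_subgroups lt) K H ->
        factor_order_isomorphic R lt H K].

(* Main.v *)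
From mathcomp Require Import all_boot all_order all_algebra.
From mathcomp Require Import all_classical all_reals.
From mathcomp Require Import zify ring lra.
Require Import Defs.

(** Let < be a bi-order on G.  As G is finitely generated, it is the top of a
    convex jump C -> G, and by Hoelder's theorem G/C embeds in the additive
    group of reals.  A nontrivial finitely generated group of reals maps onto
    the integers, so there are psi : G -> Z and a in G with psi a = 1.  Write
    x = a^k n with k = psi x and psi n = 0, and compare elements first by n,
    then by k.  Replacing x by x h replaces n by a^(- psi h) n h, so the
    bi-invariance of < makes this a right order; a is its least element above
    1.

    If < is central, its convex subgroups E are normal, and the sets of all
    x = a^k n with n in E are convex subgroups of the new order.  Each jump of
    the new order is either 1 -> <a>, or is obtained in this way from a jump
    C -> D of <; in the latter case x |-> phi n, with phi the Hoelder embedding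
    of D/C, is a homomorphism because [D, G] lies in C.

    For Hoelder's theorem, fix g > 1 in D outside C and let f x be the k with
    g^k <= x < g^(k+1).  Then f (x y) - f x - f y is 0 or 1, and phi x is the
    limit of f (x^n) / n.  If x y <= y x then x^n y^n <= (x y)^n <= y^n x^n,
    which makes phi additive without knowing that D/C is commutative. *)

Set Implicit Arguments.
Unset Strict Implicit.
Unset Printing Implicit Defensive.

Import Order.TTheory GRing.Theory Num.Theory.

Local Open Scope classical_set_scope.
Local Open Scope group_scope.

(** * Right orders and their convex subgroups *)

Section IntegerPowers.
Variable G : groupType.
Implicit Types (a : G) (k l : int).

Definition zpow a k : G :=
  match k with Posz n => a ^+ n | Negz n => (a ^+ n.+1)^-1 end.

Lemma zpowS a k : zpow a (k + 1)%R = zpow a k * a.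
Proof.
case: k => [n|[|n]]; first by rewrite -PoszD addn1 /= expgSr.
  by rewrite /= expg1 mulVg.
have -> : (Negz n.+1 + 1 = Negz n)%R by lia.
by rewrite /= [X in (X)^-1 * _]expgS invgM mulgVK.
Qed.

Lemma zpowD a k l : zpow a (k + l)%R = zpow a k * zpow a l.
Proof.
elim/int_rect: l => [|n IH|n IH]; first by rewrite addr0 mulg1.
  have -> : (k + n.+1%:Z = k + n%:Z + 1)%R by lia.
  by rewrite zpowS IH /= expgSr mulgA.
apply: (mulIg a); rewrite -mulgA -!zpowS.
have -> : (k - n.+1%:Z + 1 = k - n%:Z)%R by lia.
by have -> : (- n.+1%:Z + 1 = - n%:Z)%R by lia.
Qed.

Lemma zpowN a k : zpow a (- k)%R = (zpow a k)^-1.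
Proof. by apply: (mulgI (zpow a k)); rewrite -zpowD subrr mulgV. Qed.

End IntegerPowers.

Section Subgroups.
Variable G : groupType.
Implicit Types H : set G.

Lemma subgroupX H x n : subgroup H -> H x -> H (x ^+ n).
Proof.
by case=> H1 HM _ Hx; elim: n => [//|n IH]; rewrite expgS; exact: HM.
Qed.

Lemma subgroup_zpow H x k : subgroup H -> H x -> H (zpow x k).
Proof.
by move=> sH Hx; case: k => n /=; [|case: (sH) => _ _; apply]; exact: subgroupX.
Qed.

End Subgroups.

Section RightOrderTheory.
Variables (G : groupType) (lt : G -> G -> Prop).
Hypothesis ro : right_order lt.
Implicit Types (x y z : G) (C D E : set G).

Definition rle x y := x = y \/ lt x y.

Lemma rltxx x : ~ lt x x.
Proof. by case: ro => -[+ _ _] _; apply. Qed.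

Lemma rlt_trans y x z : lt x y -> lt y z -> lt x z.
Proof. by case: ro => -[_ + _] _; apply. Qed.

Lemma rlt_total x y : x <> y -> lt x y \/ lt y x.
Proof. by case: ro => -[_ _ +] _; apply. Qed.

Lemma rltMr z x y : lt x y -> lt (x * z) (y * z).
Proof. by case: ro => _; apply. Qed.

Lemma rle_refl x : rle x x. Proof. by left. Qed.

Lemma rltW x y : lt x y -> rle x y. Proof. by right. Qed.

Lemma rle_trans y x z : rle x y -> rle y z -> rle x z.
Proof.
case=> [->//|xy] [<-|yz]; first exact: rltW.
by right; exact: rlt_trans yz.
Qed.

Lemma rle_lt_trans y x z : rle x y -> lt y z -> lt x z.
Proof. by case=> [->//|xy] yz; exact: rlt_trans yz. Qed.

Lemma rlt_le_trans y x z : lt x y -> rle y z -> lt x z.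
Proof. by move=> xy [<-//|yz]; exact: rlt_trans yz. Qed.

Lemma rleNlt x y : rle x y <-> ~ lt y x.
Proof.
split=> [xy yx|nyx]; first exact: rltxx (rle_lt_trans xy yx).
by have [->|/rlt_total[]//] := pselect (x = y); [left|right].
Qed.

Lemma rle_or_lt x y : rle x y \/ lt y x.
Proof. by have [|/rleNlt] := pselect (lt y x); [right|left]. Qed.

Lemma rle_total x y : rle x y \/ rle y x.
Proof. by have [|/rltW] := rle_or_lt x y; [left|right]. Qed.

Lemma rleMr z x y : rle x y -> rle (x * z) (y * z).
Proof. by case=> [->|xy]; [left|right; exact: rltMr]. Qed.

Lemma rlt1V x : lt x 1 -> lt 1 x^-1.
Proof. by move=> /(rltMr x^-1); rewrite mulgV mul1g. Qed.

Lemma convexP E x y z : convex lt E -> rle x y -> rle y z -> E x -> E z -> E y.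
Proof. by move=> cE [->//|xy] [<-//|yz]; exact: cE. Qed.

Lemma convex_subgroups1 : convex_subgroups lt [set 1].
Proof.
split; first by split=> [//|x y -> ->|x ->] /=; rewrite ?mulg1 ?invg1.
by move=> x y z xy yz /= ex ez; case: (@rltxx x); rewrite {2}ex -ez;
  exact: rlt_trans yz.
Qed.

Lemma convex_subgroupsT : convex_subgroups lt setT.
Proof. by []. Qed.

(** The element [y] is [x] or its inverse, so every subgroup containing [x] contains [y]. Arguments
    about convex subgroups thus reduce to elements above 1. *)
Lemma subgroup_notin_pos C x : subgroup C -> ~ C x ->
  exists y, [/\ lt 1 y, ~ C y & forall E, subgroup E -> E x -> E y].
Proof.
move=> [C1 _ CV] nCx; have [x1|/rlt_total[x1|x1]] := pselect (x = 1).
- by rewrite x1 in nCx.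
- exists x^-1; split; [exact: rlt1V| |by move=> E [_ _]; apply].
  by move=> /CV; rewrite invgK.
- by exists x.
Qed.

(** Given an element above 1 in each of the two differences, the smaller lies between 1 and the
    larger, so convexity puts it in the other subgroup. *)
Lemma convex_subgroups_total : total_on (convex_subgroups lt) subset.
Proof.
move=> C D [sC cC] [sD cD].
have [|nCD] := pselect (C `<=` D); first by left.
right=> y Dy; apply: contrapT => nCy; apply: nCD => x Cx.
apply: contrapT => nDx.
have [x' [x1 nDx' Cx']] := subgroup_notin_pos sD nDx.
have [y' [y1 nCy' Dy']] := subgroup_notin_pos sC nCy.
have {}Cx' := Cx' _ sC Cx; have {}Dy' := Dy' _ sD Dy.
have [xy|/rltW yx] := rle_or_lt x' y'.
  by apply: nDx'; apply: (convexP cD (rltW x1) xy) => //; case: sD.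
by apply: nCy'; apply: (convexP cC (rltW y1) yx) => //; case: sC.
Qed.

Lemma convex_subgroups_bigcap (F : set (set G)) :
  F `<=` convex_subgroups lt -> convex_subgroups lt (\bigcap_(H in F) H).
Proof.
move=> sF; split; last first.
  by move=> x y z xy yz Fx Fz H FH; have [_ cH] := sF H FH;
    exact: (cH x y z xy yz (Fx _ FH) (Fz _ FH)).
split=> [H|x y Fx Fy H|x Fx H] FH; have [[H1 HM HV] _] := sF H FH.
- by [].
- by apply: HM; [exact: Fx|exact: Fy].
- by apply: HV; exact: Fx.
Qed.

Lemma convex_subgroups_bigcup (F : set (set G)) :
  F `<=` convex_subgroups lt -> F !=set0 ->
  convex_subgroups lt (\bigcup_(H in F) H).
Proof.
move=> sF [H0 FH0].
have Fdir H1 H2 x y : F H1 -> F H2 -> H1 x -> H2 y ->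
    exists H, [/\ F H, H x & H y].
  move=> FH1 FH2 Hx Hy.
  have [H12|H21] := convex_subgroups_total (sF _ FH1) (sF _ FH2).
    by exists H2; split=> //; exact: H12.
  by exists H1; split=> //; exact: H21.
split; last first.
  move=> x y z xy yz [H1 FH1 Hx] [H2 FH2 Hz].
  have [H [FH {}Hx {}Hz]] := Fdir _ _ _ _ FH1 FH2 Hx Hz.
  by exists H => //; have [_ cH] := sF _ FH; exact: (cH x y z).
split=> [|x y [H1 FH1 Hx] [H2 FH2 Hy]|x [H FH Hx]].
- by exists H0 => //; have [[]] := sF _ FH0.
- have [H [FH {}Hx {}Hy]] := Fdir _ _ _ _ FH1 FH2 Hx Hy.
  by exists H => //; have [[_ + _] _] := sF _ FH; apply.
- by exists H => //; have [[_ _ +] _] := sF _ FH; apply.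
Qed.

Definition jump_bottom g : set G :=
  \bigcup_(E in [set E | convex_subgroups lt E /\ ~ E g]) E.

Definition jump_top g : set G :=
  \bigcap_(E in [set E | convex_subgroups lt E /\ E g]) E.

Lemma jump_bottom_notin g : ~ jump_bottom g g.
Proof. by case=> E [_ nEg] Eg. Qed.

Lemma jump_top_in g : jump_top g g.
Proof. by move=> E []. Qed.

Lemma jump_top_sub g E : convex_subgroups lt E -> E g -> jump_top g `<=` E.
Proof. by move=> cE Eg x; apply. Qed.

Lemma jump_bottom_sup g E : convex_subgroups lt E -> ~ E g ->
  E `<=` jump_bottom g.
Proof. by move=> cE nEg x Ex; exists E. Qed.

Lemma jump_top_convex g : convex_subgroups lt (jump_top g).
Proof. by apply: convex_subgroups_bigcap => E []. Qed.

(** For [g = 1] the union would be empty, since every subgroup contains 1. *)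
Lemma jump_bottom_convex g : g <> 1 -> convex_subgroups lt (jump_bottom g).
Proof.
move=> g1; apply: convex_subgroups_bigcup => [E []//|].
by exists [set 1]; split; [exact: convex_subgroups1|].
Qed.

Lemma jumpP g : g <> 1 -> convex_jump lt (jump_bottom g) (jump_top g).
Proof.
move=> g1; have cb := jump_bottom_convex g1; have ct := jump_top_convex g.
split=> //.
  split; last by move=> /(_ _ (@jump_top_in g)) /jump_bottom_notin.
  move=> x [E [cE nEg] Ex].
  have [sEt|stE] := convex_subgroups_total cE ct; first exact: sEt.
  by case: nEg; exact: (stE g (@jump_top_in g)).
move=> [E [cE [_ nEb] [_ ntE]]]; have [Eg|nEg] := pselect (E g).
  by apply: ntE; exact: jump_top_sub.
by apply: nEb; exact: jump_bottom_sup.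
Qed.

End RightOrderTheory.

(** * Powers of a product and limits of almost additive sequences *)

Section PreorderedPowers.
Variables (G : groupType) (r : G -> G -> Prop).
Hypothesis r_refl : forall x, r x x.
Hypothesis r_trans : forall y x z, r x y -> r y z -> r x z.
Hypothesis rMr : forall z x y, r x y -> r (x * z) (y * z).
Hypothesis rMl : forall z x y, r x y -> r (z * x) (z * y).

(** The factors are moved past each other one at a time. A general preorder covers both [le] and its
    converse, according to which of [x * y] and [y * x] is smaller. *)
Lemma expg_mul_between x y n : r (x * y) (y * x) ->
  r (x ^+ n * y ^+ n) ((x * y) ^+ n) /\ r ((x * y) ^+ n) (y ^+ n * x ^+ n).
Proof.
move=> xy; have xyX m : r (x * y ^+ m) (y ^+ m * x).
  elim: m => [|m IH]; first by rewrite expg0 mulg1 mul1g; exact: r_refl.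
  rewrite expgSr mulgA; apply: r_trans (rMr y IH) _.
  by rewrite -!mulgA; exact: rMl.
elim: n => [|n [IHl IHr]]; first by rewrite !expg0 mulg1; split; exact: r_refl.
split.
  rewrite [X in r _ X]expgSr; apply: r_trans (rMr (x * y) IHl).
  rewrite (expgSr x) (expgSr y) -!mulgA; apply: rMl.
  by rewrite !mulgA; apply: rMr; exact: xyX.
rewrite [X in r X _]expgS; apply: r_trans (rMl (x * y) IHr) _.
rewrite mulgA -(mulgA x) -expgS (expgS x) mulgA; apply: rMr; exact: xyX.
Qed.

End PreorderedPowers.

Section RealLimits.
Variable R : realType.
Local Open Scope ring_scope.

(** By the Archimedean property. It turns estimates with a bounded error, valid for all powers, into
    exact equations. *)
Lemma bounded_multiples_eq0 (r : R) (c : nat) :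
  (forall n : nat, (0 < n)%N -> `|n%:R * r| <= c%:R) -> r = 0.
Proof.
move=> nr; apply/eqP; rewrite -normr_le0 leNgt; apply/negP => r0.
have /archi_boundP : 0 <= c%:R / `|r| by rewrite divr_ge0 // ltW.
set N := Num.Def.archi_bound _ => cN.
have N0 : (0 < N)%N.
  by rewrite -(ltr_nat R); apply: le_lt_trans cN; rewrite divr_ge0 // ltW.
have := nr _ N0; rewrite normrM normr_nat leNgt => /negP; apply.
by rewrite -ltr_pdivrMr.
Qed.

(* Both hypotheses say that [u] is additive up to an error of [1]; then
   [u m / m] converges, and its limit is the supremum of these quotients. *)
Lemma quasi_additive_limit (u : nat -> int) :
  (forall n m, (0 < n)%N -> (0 < m)%N -> n%:Z * u m <= u (n * m)%N) ->
  (forall n m, (0 < n)%N -> (0 < m)%N -> u (n * m)%N + 1 <= n%:Z * (u m + 1)) ->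
  exists r : R, forall m, (0 < m)%N ->
    (u m)%:~R <= m%:R * r /\ m%:R * r <= (u m)%:~R + 1.
Proof.
move=> lo hi.
pose A := [set ((u n)%:~R / n%:R : R) | n in [set n | (0 < n)%N]].
(* The quotients at [n] and at [m] are both compared with the value of [u] at [n * m]. *)
have ubA m : (0 < m)%N -> ubound A (((u m)%:~R + 1) / m%:R).
  move=> m0 _ [n /= n0 <-].
  rewrite ler_pdivrMr ?ltr0n // mulrAC ler_pdivlMr ?ltr0n //.
  have : u n * m%:Z <= (u m + 1) * n%:Z.
    have := lo _ _ m0 n0; have := hi _ _ n0 m0; rewrite (mulnC n) => a b.
    lia.
  by rewrite -(ler_int R) !intrM !intrD -!pmulrn.
exists (sup A) => m m0; have A0 : A !=set0 by exists ((u m)%:~R / m%:R), m.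
have mR : 0 < m%:R :> R by rewrite ltr0n.
split; rewrite mulrC.
  rewrite -ler_pdivrMr //; apply: ub_le_sup; last by exists m.
  by exists (((u m)%:~R + 1) / m%:R); exact: ubA.
by rewrite -ler_pdivlMr //; apply: ge_sup => //; exact: ubA.
Qed.

End RealLimits.

(** * Hoelder's theorem for convex jumps of a bi-order *)

Section BiOrderTheory.
Variables (G : groupType) (lt : G -> G -> Prop).
Hypothesis bo : bi_order lt.
Let ro : right_order lt := bo.1.
Implicit Types (x y z g : G) (C D E H : set G).
Local Notation le := (rle lt).

Lemma rltMl z x y : lt x y -> lt (z * x) (z * y).
Proof. by case: bo => _; apply. Qed.

Lemma rleMl z x y : le x y -> le (z * x) (z * y).
Proof. by case=> [->|xy]; [left|right; exact: rltMl]. Qed.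

Lemma rleM x y u v : le x y -> le u v -> le (x * u) (y * v).
Proof. by move=> xy uv; apply: (rle_trans ro (rleMr ro u xy)); exact: rleMl. Qed.

Lemma rleX x y n : le x y -> le (x ^+ n) (y ^+ n).
Proof.
move=> xy; elim: n => [|n IH]; first exact: rle_refl.
by rewrite !expgS; exact: rleM.
Qed.

Lemma rleV x y : le x y -> le y^-1 x^-1.
Proof.
move=> /(rleMl x^-1)/(rleMr ro y^-1).
by rewrite mulVg mul1g mulgK.
Qed.

Lemma expg_ge1 g n : lt 1 g -> le 1 (g ^+ n).
Proof. by move=> /(@rltW _ lt)/(rleX n); rewrite expg1n. Qed.

Lemma zpow_le g k l : lt 1 g -> (k <= l)%R -> le (zpow g k) (zpow g l).
Proof.
move=> g1 kl; have [n ->] : exists n : nat, l = (k + n%:Z)%R.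
  by exists `|l - k|%N; lia.
by rewrite zpowD -{1}[zpow g k]mulg1; apply: rleMl; exact: expg_ge1.
Qed.

Lemma zpow_lt_inv g k l : lt 1 g -> lt (zpow g k) (zpow g l) -> (k < l)%R.
Proof.
move=> g1 kl; rewrite ltNge; apply/negP => /(zpow_le g1) lk.
exact: (rltxx ro (rlt_le_trans ro kl lk)).
Qed.

Definition convex_hull H : set G :=
  [set x | exists u v, [/\ H u, H v, le u x & le x v]].

Lemma sub_convex_hull H : H `<=` convex_hull H.
Proof. by move=> x Hx; exists x, x; split=> //; exact: rle_refl. Qed.

(** Products and inverses of bounds from [H] bound products and inverses, by invariance on both
    sides. *)
Lemma convex_hull_convex H : subgroup H -> convex_subgroups lt (convex_hull H).
Proof.
move=> sH; have [H1 HM HV] := sH; split; last first.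
  move=> x y z /(@rltW _ lt) xy /(@rltW _ lt) yz [u [_ [Hu _ ux _]]].
  move=> [_ [v [_ Hv _ zv]]]; exists u, v; split=> //.
    exact: rle_trans xy.
  exact: rle_trans zv.
split=> [|x y [u [v [Hu Hv ux xv]]] [s [t [Hs Ht sy yt]]]|x [u [v [Hu Hv ux xv]]]].
- exact: sub_convex_hull.
- by exists (u * s), (v * t); split; [exact: HM|exact: HM|exact: rleM|exact: rleM].
- by exists v^-1, u^-1; split; [exact: HV|exact: HV|exact: rleV|exact: rleV].
Qed.

Lemma subgroup_zpows g : subgroup (range (zpow g)).
Proof.
split=> [|_ _ [k _ <-] [l _ <-]|_ [k _ <-]]; first by exists 0%R.
  by exists (k + l)%R => //; rewrite zpowD.
by exists (- k)%R => //; rewrite zpowN.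
Qed.

Section Hoelder.
Variables (C D : set G).
Hypothesis CD : convex_jump lt C D.

(** The convex hull of the powers of [g] is a convex subgroup inside [D] that properly contains [C],
    so the jump forces it to be [D]. *)
Lemma jump_archimedean g x : D g -> ~ C g -> D x -> exists k l,
  le (zpow g k) x /\ le x (zpow g l).
Proof.
case: CD => cC cD [sCD nDC] nE Dg nCg Dx.
have cE := convex_hull_convex (subgroup_zpows g).
have Eg : convex_hull (range (zpow g)) g.
  by apply: sub_convex_hull; exists 1%R.
have sED : convex_hull (range (zpow g)) `<=` D.
  move=> y [_ [_ [[k _ <-] [l _ <-] ky yl]]].
  by apply: (convexP cD.2 ky yl); apply: subgroup_zpow => //; case: cD.
have sCE : C `<=` convex_hull (range (zpow g)).
  by have [//|/(_ _ Eg)] := convex_subgroups_total ro cC cE.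
have /contrapT : ~ ~ convex_hull (range (zpow g)) x.
  move=> nEx; apply: nE; exists (convex_hull (range (zpow g))); split=> //.
    by split=> // /(_ _ Eg).
  by split=> // /(_ _ Dx).
by move=> [_ [_ [[k _ <-] [l _ <-] kx xl]]]; exists k, l.
Qed.

Variables (g : G).
Hypotheses (Dg : D g) (nCg : ~ C g) (g1 : lt 1 g).

Let sD : subgroup D. Proof. by case: CD => _ []. Qed.
Let sC : subgroup C. Proof. by case: CD => -[]. Qed.

Definition is_floor x k := le (zpow g k) x /\ lt x (zpow g (k + 1)%R).

Lemma floor_exists x : D x -> exists k, is_floor x k.
Proof.
move=> Dx; have [k [l [kx xl]]] := jump_archimedean Dg nCg Dx.
have [n xn] : exists n : nat, lt x (zpow g (k + n%:Z)%R).
  (* The added 1 makes the upper bound strict; the search then descends from it towards [k]. *)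
  exists `|(l + 1 - k)%R|%N; apply: (rle_lt_trans ro xl).
  apply: (rlt_le_trans ro (_ : lt _ (zpow g (l + 1)%R))).
    by rewrite zpowD -{1}[zpow g l]mulg1; exact: rltMl.
  by apply: zpow_le => //; lia.
elim: n xn => [|n IH] xn.
  by rewrite addr0 in xn; case: (rltxx ro (rle_lt_trans ro kx xn)).
have [nx|xn'] := rle_or_lt ro (zpow g (k + n%:Z)%R) x; last exact: IH.
exists (k + n%:Z)%R; split=> //.
by have -> : (k + n%:Z + 1 = k + n.+1%:Z)%R by lia.
Qed.

Lemma is_floor_le x y k l : is_floor x k -> is_floor y l -> le x y -> (k <= l)%R.
Proof.
move=> [kx _] [_ yl] xy; rewrite -ltzD1; apply: (zpow_lt_inv g1).
by apply: (rle_lt_trans ro _ yl); exact: rle_trans xy.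
Qed.

Lemma is_floorM x y k l m :
  is_floor x k -> is_floor y l -> is_floor (x * y) m ->
  (k + l <= m /\ m <= k + l + 1)%R.
Proof.
move=> [kx xk] [ly yl] [mxy xym].
split; rewrite -ltzD1; apply: (zpow_lt_inv g1).
  by apply: (rle_lt_trans ro _ xym); rewrite zpowD; exact: rleM.
apply: (rle_lt_trans ro mxy).
have -> : (k + l + 1 + 1 = (k + 1) + (l + 1))%R by lia.
rewrite zpowD; apply: (rlt_le_trans ro (rltMl x yl)).
by apply: rleMr => //; exact: rltW.
Qed.

(** Each of the [n] multiplications adds an error of 0 or 1, whence [m <= n.+1 * k + n]. These
    bounds are the two hypotheses of [quasi_additive_limit]. *)
Lemma is_floorX x k n m : D x -> is_floor x k -> is_floor (x ^+ n.+1) m ->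
  (n.+1%:Z * k <= m /\ m + 1 <= n.+1%:Z * (k + 1))%R.
Proof.
move=> Dx xk; elim: n m => [|n IH] m.
  rewrite expg1 => xm; have /= := is_floor_le xk xm (rle_refl _ _).
  by have := is_floor_le xm xk (rle_refl _ _); lia.
rewrite expgS => xm.
have [l xl] := floor_exists (subgroupX n.+1 sD Dx).
have [] := IH _ xl; have [] := is_floorM xk xl xm.
rewrite (intS n.+1) !mulrDl !mul1r; lia.
Qed.

Variable R : realType.

Lemma hoelder_pos : exists phi : G -> R,
  [/\ forall x y, D x -> D y -> phi (x * y) = (phi x + phi y)%R,
      forall x, D x -> phi x = 0%R <-> C x &
      forall x y, D x -> D y -> (phi x < phi y)%R -> lt x y].
Proof.
(* Floors exist on [D] by [floor_exists]; elsewhere [fl] may take the default 0. *)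
pose fl x := xget 0%R [set k | is_floor x k].
have flP x : D x -> is_floor x (fl x).
  by move=> Dx; apply: (@xgetPex _ 0%R [set k | is_floor x k]); exact: floor_exists.
have DX x n : D x -> D (x ^+ n) by exact: subgroupX.
have DM x y : D x -> D y -> D (x * y) by case: sD => _ + _; apply.
pose isphi x (r : R) := forall m, (0 < m)%N ->
  ((fl (x ^+ m)%g)%:~R <= m%:R * r /\ m%:R * r <= (fl (x ^+ m)%g)%:~R + 1)%R.
pose phi x := xget 0%R [set r | isphi x r].
have phiP x : D x -> isphi x (phi x).
  move=> Dx; apply: (@xgetPex _ 0%R [set r | isphi x r]).
  apply: quasi_additive_limit => [[//|n] m _ _|[//|n] m _ _].
    have := is_floorX (DX x m Dx) (flP _ (DX x m Dx)).
    by move=> /(_ n (fl (x ^+ (n.+1 * m)))); rewrite -expgnA (mulnC m) => -[|//];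
      apply: flP; exact: DX.
  have := is_floorX (DX x m Dx) (flP _ (DX x m Dx)).
  by move=> /(_ n (fl (x ^+ (n.+1 * m)))); rewrite -expgnA (mulnC m) => -[|//];
    apply: flP; exact: DX.
have fl_le x y : D x -> D y -> le x y -> (fl x <= fl y)%R.
  by move=> Dx Dy; apply: is_floor_le; exact: flP.
have flM x y : D x -> D y ->
    (fl x + fl y <= fl (x * y)%g /\ fl (x * y)%g <= fl x + fl y + 1)%R.
  by move=> Dx Dy; apply: is_floorM; apply: flP => //; exact: DM.
(* The power of [x * y] lies between [x ^+ n * y ^+ n] and [y ^+ n * x ^+ n], and [flM] gives the
   floors of both products the same bounds. *)
have fl_pow x y n : D x -> D y ->
    (fl (x ^+ n)%g + fl (y ^+ n)%g <= fl ((x * y) ^+ n)%g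
    /\ fl ((x * y) ^+ n)%g <= fl (x ^+ n)%g + fl (y ^+ n)%g + 1)%R.
  move=> Dx Dy; have Dxn := DX x n Dx; have Dyn := DX y n Dy.
  have Dxyn := DX _ n (DM _ _ Dx Dy).
  have Hxy := flM _ _ Dxn Dyn; have Hyx := flM _ _ Dyn Dxn.
  have [xy|yx] := rle_total ro (x * y) (y * x).
    have [] := expg_mul_between (@rle_refl _ lt) (@rle_trans _ _ ro)
      (@rleMr _ _ ro) rleMl n xy.
    move=> /(fl_le _ _ (DM _ _ Dxn Dyn) Dxyn) lo.
    move=> /(fl_le _ _ Dxyn (DM _ _ Dyn Dxn)) hi.
    lia.
  have [] := @expg_mul_between _ (fun x y => le y x) (@rle_refl _ lt)
    (fun y x z xy yz => rle_trans ro yz xy)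
    (fun z x y => @rleMr _ _ ro z y x) (fun z x y => @rleMl z y x) x y n yx.
  move=> /(fl_le _ _ Dxyn (DM _ _ Dxn Dyn)) hi.
  move=> /(fl_le _ _ (DM _ _ Dyn Dxn) Dxyn) lo.
  lia.
have phiM x y : D x -> D y -> phi (x * y) = (phi x + phi y)%R.
  move=> Dx Dy; apply/eqP; rewrite -subr_eq0; apply/eqP.
  (* After multiplication by [n], each of the three values of [phi] exceeds its floor by at most 1,
     and [fl_pow] contributes at most 1 more; in either direction these errors add up to at most
     2. *)
  apply: (@bounded_multiples_eq0 _ _ 2) => n n0.
  have [x1 x2] := phiP _ Dx _ n0; have [y1 y2] := phiP _ Dy _ n0.
  have [z1 z2] := phiP _ (DM _ _ Dx Dy) _ n0.
  have [] := fl_pow _ _ n Dx Dy; rewrite -!(ler_int R) !intrD => f1 f2.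
  rewrite ler_norml !mulrDr !mulrN; apply/andP; split; lra.
have phi_le x y : D x -> D y -> le x y -> (phi x <= phi y)%R.
  move=> Dx Dy xy; rewrite leNgt; apply/negP => yx.
  (* Since floors are monotone, [n * (phi y - phi x)] stays between -1 and 0 for every positive
     [n]. *)
  suff : (phi y - phi x = 0)%R by move=> e; rewrite -subr_lt0 e ltxx in yx.
  apply: (@bounded_multiples_eq0 _ _ 1) => n n0.
  have [x1 x2] := phiP _ Dx _ n0; have [y1 y2] := phiP _ Dy _ n0.
  have := fl_le _ _ (DX x n Dx) (DX y n Dy) (rleX n xy).
  rewrite -(ler_int R) => f1.
  have : (n%:R * phi y <= n%:R * phi x)%R by rewrite ler_wpM2l ?ler0n // ltW.
  rewrite ler_norml !mulrDr !mulrN => f2; apply/andP; split; lra.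
have phi1 : phi 1 = 0%R.
  have D1 : D 1 by case: sD.
  by apply: (@addrI _ (phi 1)); rewrite addr0 -phiM // mulg1.
have DV x : D x -> D x^-1 by case: sD => _ _; apply.
have phiV x : D x -> phi x^-1 = (- phi x)%R.
  move=> Dx; apply/eqP; rewrite -addr_eq0 -phiM ?mulVg ?phi1 //; exact: DV.
(* Some positive power of [x] reaches [g], so its floor is at least 1. *)
have pos x : D x -> ~ C x -> lt 1 x -> (0 < phi x)%R.
  move=> Dx nCx x1; have [_ [l [_ gl]]] := jump_archimedean Dx nCx Dg.
  have {}gl : le g (x ^+ (`|l|.+1)%N).
    by apply: (rle_trans ro gl); apply: (@zpow_le _ _ (Posz `|l|.+1)) => //; lia.
  have [/= lo _] := phiP _ Dx `|l|.+1 isT.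
  have f1 : (1 <= fl (x ^+ `|l|.+1)%g)%R.
    apply: (is_floor_le _ (flP _ (DX _ _ Dx)) gl); split; first exact: rle_refl.
    by rewrite (zpowD _ 1%R) -{1}[g]mulg1; exact: rltMl.
  rewrite -(ler_int R) in f1.
  rewrite -(@pmulr_rgt0 _ `|l|.+1%:R%R) ?ltr0n //.
  by apply: lt_le_trans (le_trans f1 lo); exact: ltr01.
exists phi; split=> // [x Dx|x y Dx Dy xy]; last first.
  by have [/phi_le|//] := rle_or_lt ro y x; rewrite leNgt xy => /(_ Dy Dx).
split=> [x0|Cx]; last first.
  (* The powers of [x] stay in [C], so by convexity they cannot pass [g] or its inverse, and their
     floors are -1 or 0. *)
  apply: (@bounded_multiples_eq0 _ _ 1) => n n0.
  have [lo hi] := phiP _ Dx _ n0.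
  have [fl1 fl2] := flP _ (DX _ n Dx).
  have CX : C (x ^+ n) by exact: subgroupX.
  have CV : C (x ^+ n)^-1 by case: sC => _ _; apply.
  have C1 : C 1 by case: sC.
  have cC : convex lt C by case: CD => -[].
  have f1 : (fl (x ^+ n)%g < 1)%R.
    rewrite ltNge; apply/negP => /(zpow_le g1) gn; apply: nCg.
    by apply: (convexP cC (rltW g1) _ C1 CX); exact: rle_trans fl1.
  have f2 : (-1 <= fl (x ^+ n)%g)%R.
    rewrite leNgt; apply/negP => ln; apply: nCg.
    apply: (convexP cC (rltW g1) _ C1 CV); rewrite -[g]invgK; apply: rleV.
    apply: (rle_trans ro (rltW fl2)).
    by apply: (@zpow_le g _ (-1)%R) => //; lia.
  have f3 : ((fl (x ^+ n)%g)%:~R <= 0 :> R)%R by rewrite (ler_int R _ 0); lia.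
  rewrite -(ler_int R) intrN in f2.
  by rewrite ler_norml; apply/andP; split; lra.
apply: contrapT => nCx.
have x1 : x <> 1 by move=> e; apply: nCx; rewrite e; case: sC.
have [xlt|xgt] := rlt_total ro x1.
  have nCV : ~ C x^-1 by case: sC => _ _ CV /CV; rewrite invgK.
  have := pos x^-1 (DV _ Dx) nCV (rlt1V ro xlt).
  by rewrite phiV // x0 oppr0 ltxx.
by have := pos x Dx nCx xgt; rewrite x0 ltxx.
Qed.

End Hoelder.

Lemma hoelder (R : realType) C D : convex_jump lt C D -> exists phi : G -> R,
  [/\ forall x y, D x -> D y -> phi (x * y) = (phi x + phi y)%R,
      forall x, D x -> phi x = 0%R <-> C x &
      forall x y, D x -> D y -> (phi x < phi y)%R -> lt x y].
Proof.
move=> CD; have [[sC _] [sD _] [_ nDC] _] := CD.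
have [x /not_implyP[Dx nCx]] : exists x, ~ (D x -> C x).
  by apply/existsNP => DC; exact: nDC.
have [y [y1 nCy Dy]] := subgroup_notin_pos ro sC nCx.
exact: (hoelder_pos CD (Dy _ sD Dx) nCy y1).
Qed.

End BiOrderTheory.

(** * Infinite cyclic quotients *)

Section IntegerQuotient.
Variable R : realType.
Local Open Scope ring_scope.

(* The reals [x i] span a finitely generated torsion-free abelian group; [v]
   gives the values at the [x i] of a nonzero homomorphism from it to int. *)
Lemma integer_functional n (x : 'I_n -> R) : (exists i, x i != 0) ->
  exists v : 'I_n -> int, (exists i, v i != 0) /\
    forall k : 'I_n -> int, \sum_i x i *~ k i = 0 -> \sum_i k i * v i = 0.
Proof.
elim: n x => [|n IH] x [i0 xi0]; first by case: i0 xi0.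
(* If every relation has coefficient 0 at [ord0], the coordinate at [ord0] is a suitable
   functional. *)
have [free|] := pselect (forall k : 'I_n.+1 -> int,
    \sum_i x i *~ k i = 0 -> k ord0 = 0).
  exists (fun i => (i == ord0)%:R); split; first by exists ord0.
  move=> k /free k0; rewrite big_ord_recl k0 mul0r add0r.
  by apply: big1 => i _; rewrite mulr0.
move=> /existsNP[k /not_implyP[xk /eqP k0]].
rewrite big_ord_recl in xk.
have [|v [[i vi] vP]] := IH (fun i => x (lift ord0 i)).
  apply: contrapT => /forallNP x0; apply: (negP xi0).
  have {}x0 i : x (lift ord0 i) = 0 by apply/eqP/negP => /negP; exact: x0.
  move: xk; rewrite big1 => [|i _]; last by rewrite x0 mul0rz.
  rewrite addr0 => /eqP; rewrite mulrz_eq0 (negPf k0) /= => /eqP x00.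
  by case: (unliftP ord0 i0) => [j|] ->; rewrite ?x0 ?x00.
(* The relation [k] expresses [x ord0] through the other values with denominator [k ord0]; scaling
   [v] by [k ord0] keeps the extension integral. *)
pose w i := if unlift ord0 i is Some j then k ord0 * v j
            else - \sum_j k (lift ord0 j) * v j.
exists w; split.
  by exists (lift ord0 i); rewrite /w liftK mulf_neq0.
move=> m; rewrite !big_ord_recl => xm; rewrite {1}/w unlift_none.
under [X in _ + X]eq_bigr do rewrite /w liftK.
(* This combination of the relations [m] and [k] eliminates [x ord0]. *)
have /= := vP (fun i => k ord0 * m (lift ord0 i) - m ord0 * k (lift ord0 i)).
under eq_bigr do rewrite mulrzBr.
rewrite sumrB => H.
rewrite mulrN mulr_sumr -sumrN -big_split /= -[RHS]H.
  by apply: eq_bigr => j _; ring.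
under eq_bigr do rewrite mulrC mulrzA.
under [X in _ - X]eq_bigr do rewrite mulrC mulrzA.
rewrite -!mulrz_suml.
have /eqP := xk; rewrite addrC addr_eq0 => /eqP ->.
have /eqP := xm; rewrite addrC addr_eq0 => /eqP ->.
by rewrite !mulNrz -!mulrzA (mulrC (m _)) subrr.
Qed.

Variable G : groupType.
Local Open Scope group_scope.

Lemma int_morphism1 (psi : G -> int) :
  (forall x y, psi (x * y) = (psi x + psi y)%R) -> psi 1 = 0%R.
Proof. by move=> psiM; apply: (@addrI _ (psi 1)); rewrite -psiM mulg1 addr0. Qed.

(** The values of [psi] are the multiples of its least positive value [d], because a nonzero
    remainder modulo [d] would be a smaller one; [chi] is [psi] divided by [d]. *)
Lemma int_morphism_surj (psi : G -> int) (g : G) :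
  (forall x y, psi (x * y) = (psi x + psi y)%R) -> psi g <> 0%R ->
  exists (chi : G -> int) (a : G),
    (forall x y, chi (x * y) = (chi x + chi y)%R) /\ chi a = 1%R.
Proof.
move=> psiM psig; have psi1 := int_morphism1 psiM.
have psiV x : psi x^-1 = (- psi x)%R.
  by apply/eqP; rewrite -addr_eq0 -psiM mulVg psi1.
have psiX x n : psi (x ^+ n) = (n%:Z * psi x)%R.
  elim: n => [|n IH]; first by rewrite mul0r.
  by rewrite expgS psiM IH; lia.
have psiZ x k : psi (zpow x k) = (k * psi x)%R.
  by case: k => n; rewrite /zpow ?psiV psiX ?NegzE ?mulNr.
pose P (n : nat) := `[< (0 < n)%N /\ exists x, psi x = n%:Z >].
have exP : exists n, P n.
  exists `|psi g|%N; apply/asboolP; split; first by rewrite absz_gt0; apply/eqP.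
  have [p0|p0] := leP 0%R (psi g); first by exists g; rewrite gez0_abs.
  by exists g^-1; rewrite psiV ltz0_abs.
case: (ex_minnP exP) => d /asboolP[d0 [a ad]] dmin.
have dvd x : psi x = ((psi x %/ d%:Z)%Z * d%:Z)%R.
  apply/esym/divzK; apply: contrapT => ndvd.
  have := divz_eq (psi x) d; set q := (_ %/ _)%Z; set r := (_ %% _)%Z => xqr.
  have r0 : (0 <= r)%R by apply: modz_ge0; lia.
  have rd : (r < d%:Z)%R by apply: ltz_pmod; lia.
  have rn : (r <> 0)%R.
    by move=> e; apply: ndvd; rewrite xqr e addr0 dvdz_mull.
  have /dmin : P `|r|%N.
    apply/asboolP; split; first by lia.
    exists (x * zpow a (- q)); rewrite psiM psiZ ad gez0_abs // xqr; lia.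
  by lia.
exists (fun x => (psi x %/ d%:Z)%Z), a; split=> [x y|]; last first.
  by rewrite ad divzz; lia.
apply: (@mulIf _ d%:Z); first by lia.
by rewrite mulrDl -!dvd psiM.
Qed.

Lemma finitely_generated_int_quotient (phi : G -> R) (g : G) :
  finitely_generated G ->
  (forall x y, phi (x * y) = (phi x + phi y)%R) -> phi g <> 0%R ->
  exists (psi : G -> int) (a : G),
    (forall x y, psi (x * y) = (psi x + psi y)%R) /\ psi a = 1%R.
Proof.
move=> [X [/finite_seqP[s ->] genX]] phiM phig.
have phi1 : phi 1 = 0%R.
  by apply: (@addrI _ (phi 1)); rewrite -phiM mulg1 addr0.
have phiV x : phi x^-1 = (- phi x)%R.
  by apply/eqP; rewrite -addr_eq0 -phiM mulVg phi1.
pose t (i : 'I_(size s)) := nth 1 s i.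
have sP (H : set G) : subgroup H -> (forall i : 'I_(size s), H (t i)) ->
    forall x, H x.
  move=> sH Ht x; have : generated [set` s] x by rewrite genX.
  apply; split=> // y /= ys.
  have ysz : (index y s < size s)%N by rewrite index_mem.
  by have := Ht (Ordinal ysz); rewrite /t /= nth_index.
have /choice[k kP] : forall x, exists k : 'I_(size s) -> int,
    phi x = (\sum_i phi (t i) *~ k i)%R.
  apply: sP => [|i].
    split=> [|x y [k kx] [l ly]|x [k kx]].
    - by exists (fun=> 0%R); rewrite phi1 big1.
    - exists (fun i => k i + l i)%R.
      by rewrite phiM kx ly -big_split; apply: eq_bigr => i _; rewrite mulrzDr.
    - exists (fun i => - k i)%R.
      by rewrite phiV kx -sumrN; apply: eq_bigr => i _; rewrite mulrNz.
  exists (fun j => (j == i)%:R%R); rewrite (bigD1 i) //= eqxx.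
  by rewrite big1 ?addr0 // => j /negPf ->.
have [|v [[i vi] vP]] := @integer_functional _ (fun i : 'I_(size s) => phi (t i)).
  apply: contrapT => /forallNP phit; apply: phig.
  rewrite (kP g) big1 // => i _.
  by have /negP/negPn/eqP -> := phit i; rewrite mul0rz.
pose psi x := (\sum_i k x i * v i)%R.
(* The coefficients [k x] are an arbitrary choice and need not be additive in [x]. Two choices
   differ by a relation among the [phi (t i)], which [v] annihilates. *)
have psiP x l : phi x = (\sum_i phi (t i) *~ l i)%R -> psi x = (\sum_i l i * v i)%R.
  move=> xl; apply/eqP; rewrite -subr_eq0 -sumrB; apply/eqP.
  under eq_bigr do rewrite -mulrBl.
  apply: (vP (fun i => k x i - l i)%R).
  under eq_bigr do rewrite mulrzBr.
  by rewrite sumrB -kP -xl subrr.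
apply: (@int_morphism_surj psi (t i)) => [x y|].
  rewrite (psiP _ (fun i => k x i + k y i)%R).
    by under eq_bigr do rewrite mulrDl; rewrite big_split.
  by under eq_bigr do rewrite mulrzDr; rewrite big_split phiM (kP x) (kP y).
rewrite (psiP _ (fun j => (j == i)%:R%R)); last first.
  rewrite (bigD1 i) //= eqxx.
  by rewrite big1 ?addr0 // => j /negPf ->.
rewrite (bigD1 i) //= eqxx mul1r big1 ?addr0.
  exact/eqP.
by move=> j /negPf ->; rewrite mul0r.
Qed.

End IntegerQuotient.

(** * The discrete right order attached to an infinite cyclic quotient *)

Section RealFactors.
Variables (R : realType) (G : groupType) (lt : G -> G -> Prop).
Hypothesis ro : right_order lt.
Variables (K H : set G) (phi : G -> R).
Hypotheses (sH : subgroup H).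
Hypothesis phiM : forall x y, H x -> H y -> phi (x * y) = (phi x + phi y)%R.
Hypothesis phi_lt : forall x y, H x -> H y -> (phi x < phi y)%R -> lt x y.
Hypothesis ker_phi : forall x, H x -> phi x = 0%R <-> K x.
Hypothesis sKH : K `<=` H.

Let HM x y : H x -> H y -> H (x * y). Proof. by case: sH => _ + _; apply. Qed.
Let HV x : H x -> H x^-1. Proof. by case: sH => _ _; apply. Qed.
Let H1 : H 1. Proof. by case: sH. Qed.

Lemma real_factor_phi1 : phi 1 = 0%R.
Proof. by apply: (@addrI _ (phi 1)); rewrite -phiM // mulg1 addr0. Qed.

Lemma real_factor_phiV x : H x -> phi x^-1 = (- phi x)%R.
Proof.
move=> Hx; apply/eqP; rewrite -addr_eq0 -phiM ?mulVg ?real_factor_phi1 //.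
exact: HV.
Qed.

Lemma real_factor_normal : normal_in K H.
Proof.
move=> k h Kk Hh; have Hk := sKH Kk; have Hkh := HM Hk Hh.
apply/ker_phi; first by apply: HM => //; exact: HV.
rewrite conjgE phiM ?real_factor_phiV //; last exact: HV.
by rewrite phiM // (proj2 (ker_phi Hk) Kk) add0r addNr.
Qed.

Lemma real_factor_coset x y : H x -> H y -> right_coset K x y <-> phi y = phi x.
Proof.
move=> Hx Hy; split=> [[k Kk <-]|yx].
  by rewrite phiM // ?(proj2 (ker_phi (sKH Kk)) Kk) ?add0r //; exact: sKH.
exists (y * x^-1); last by rewrite mulgVK.
apply/ker_phi; first by apply: HM => //; exact: HV.
by rewrite phiM ?real_factor_phiV //; [rewrite yx subrr|exact: HV].
Qed.

Lemma real_factor : factor_order_isomorphic R lt H K.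
Proof.
have K1 : K 1 by apply/ker_phi; rewrite // real_factor_phi1.
(* A coset is sent to the value of [phi] at a chosen representative; [PhiE] shows that every
   representative gives the same value. *)
pose Phi (X : set G) : R := phi (xget 1 X).
have cH x y : H x -> right_coset K x y -> H y.
  by move=> Hx [k /sKH Hk <-]; exact: HM.
have PhiE X x : quotient_group H K X -> X x -> H x /\ phi x = Phi X.
  move=> [h Hh <-] hx; have Hx := cH _ _ Hh hx; split=> //.
  have gx : right_coset K h (xget 1 (right_coset K h)).
    exact: (@xgetI _ 1 (right_coset K h) x hx).
  rewrite /Phi; have /(real_factor_coset Hh Hx) -> := hx.
  by have /(real_factor_coset Hh (cH _ _ Hh gx)) -> := gx.
have coset_in h : right_coset K h h by exists 1; rewrite ?mul1g.
have ne X : quotient_group H K X -> exists x, X x by move=> [h _ <-]; exists h.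
exists (phi @` H), Phi; split.
- split=> [|_ _ [x Hx <-] [y Hy <-]|_ [x Hx <-]].
  + by exists 1 => //; exact: real_factor_phi1.
  + by exists (x * y); [exact: HM|exact: phiM].
  + by exists x^-1; [exact: HV|exact: real_factor_phiV].
- split.
  + by move=> X qX; have [x Xx] := ne _ qX; have [Hx <-] := PhiE _ _ qX Xx; exists x.
  + move=> X Y /set_mem qX /set_mem qY XY.
    have [x Hx eX] := qX; have [y Hy eY] := qY.
    have [_ px] : H x /\ phi x = Phi X by apply: PhiE => //; rewrite -eX.
    have [_ py] : H y /\ phi y = Phi Y by apply: PhiE => //; rewrite -eY.
    rewrite -eX -eY; apply/seteqP; split=> z zx.
      have Hz := cH _ _ Hx zx; apply/(real_factor_coset Hy Hz).
      by move/(real_factor_coset Hx Hz): zx => ->; rewrite px XY py.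
    have Hz := cH _ _ Hy zx; apply/(real_factor_coset Hx Hz).
    by move/(real_factor_coset Hy Hz): zx => ->; rewrite px XY py.
  + move=> _ [x Hx <-]; exists (right_coset K x); first by exists x.
    have qx : quotient_group H K (right_coset K x) by exists x.
    by have [_ <-] := PhiE _ x qx (coset_in x).
- move=> X Y qX qY; have [x Xx] := ne _ qX; have [y Yy] := ne _ qY.
  have [Hx px] := PhiE _ _ qX Xx; have [Hy py] := PhiE _ _ qY Yy.
  rewrite -px -py -phiM // /Phi.
  have : set_product X Y (x * y) by exists x => //; exists y.
  move=> /(@xgetI _ 1 (set_product X Y) (x * y)) [u Xu [v Yv <-]].
  have [Hu pu] := PhiE _ _ qX Xu; have [Hv pv] := PhiE _ _ qY Yv.
  by rewrite !phiM // pu pv px py.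
- move=> X Y qX qY; split=> [XY|XY x y Xx Yy]; last first.
    have [Hx px] := PhiE _ _ qX Xx; have [Hy py] := PhiE _ _ qY Yy.
    by apply: phi_lt => //; rewrite px py.
  have [x Xx] := ne _ qX; have [y Yy] := ne _ qY.
  have [Hx px] := PhiE _ _ qX Xx; have [Hy py] := PhiE _ _ qY Yy.
  have xy := XY _ _ Xx Yy; rewrite -px -py.
  have [//|yx|e] := ltgtP (phi x) (phi y).
    by case: (rltxx ro (rlt_trans ro xy (phi_lt Hy Hx yx))).
  (* If [phi x = phi y], then [y] lies in both cosets and would be below itself. *)
  suff Xy : X y by case: (rltxx ro (XY _ _ Xy Yy)).
  have [h Hh eX] := qX; rewrite -eX; apply/(real_factor_coset Hh Hy).
  rewrite -e; apply/(real_factor_coset Hh Hx).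
  by rewrite eX.
Qed.

End RealFactors.

(** A conjugate of [x] is [x] times a commutator. Centrality puts that commutator in the bottom of
    the jump at [x], hence in every convex subgroup containing [x]. *)
Lemma central_convex_normal (G : groupType) (lt : G -> G -> Prop) (E : set G) :
  right_order lt -> central lt -> convex_subgroups lt E -> normal_in E setT.
Proof.
move=> ro cen cE x g Ex _; have [[E1 EM EV] _] := cE.
have [->|x1] := pselect (x = 1); first by rewrite conj1g.
have -> : x ^ g = x * [~ x, g] by rewrite commgEl mulVKg.
apply: EM => //; apply: (jump_top_sub cE Ex).
have [_ _ [+ _] _] := jumpP ro x1; apply.
apply: (cen _ _ (jumpP ro x1)) => F [_]; apply.
by exists x; [exact: jump_top_in|exists g].
Qed.

Section CyclicLexOrder.
Variables (G : groupType) (lt : G -> G -> Prop) (psi : G -> int) (a : G).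
Hypothesis bo : bi_order lt.
Hypothesis psiM : forall x y, psi (x * y) = (psi x + psi y)%R.
Hypothesis psia : psi a = 1%R.
Let ro : right_order lt := bo.1.
Implicit Types (x y z h : G) (E H K : set G) (k l : int).

(* [G] is the semidirect product of the kernel of [psi] by the powers of [a],
   and [ker_part x] is the kernel component of [x]. *)
Definition ker_part x : G := zpow a (- psi x)%R * x.

(* The kernel component is compared first: it represents the coset of [x]
   modulo the powers of [a], so that these form a convex subgroup. *)
Definition tlt x y : Prop :=
  lt (ker_part x) (ker_part y) \/ ker_part x = ker_part y /\ (psi x < psi y)%R.

Let psi1 : psi 1 = 0%R := int_morphism1 psiM.

Lemma psiV x : psi x^-1 = (- psi x)%R.
Proof. by apply/eqP; rewrite -addr_eq0 -psiM mulVg psi1. Qed.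

Lemma psi_zpow k : psi (zpow a k) = k.
Proof.
have psiX n : psi (a ^+ n) = Posz n.
  by elim: n => [|n IH]; rewrite ?psi1 // expgS psiM IH psia; lia.
by case: k => n; rewrite /zpow ?psiV psiX ?NegzE.
Qed.

Lemma psi_ker_part x : psi (ker_part x) = 0%R.
Proof. by rewrite psiM psi_zpow addNr. Qed.

Lemma ker_part_id x : psi x = 0%R -> ker_part x = x.
Proof. by move=> x0; rewrite /ker_part x0 oppr0 mul1g. Qed.

Lemma ker_partK x : zpow a (psi x) * ker_part x = x.
Proof. by rewrite /ker_part mulgA -zpowD subrr mul1g. Qed.

Lemma ker_part1 : ker_part 1 = 1. Proof. exact: ker_part_id. Qed.

Lemma ker_part_a : ker_part a = 1.
Proof. by rewrite /ker_part psia zpowN mulVg. Qed.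

(** The factors on the two sides depend only on [h]; this is where the two-sided invariance of [lt]
    enters [tlt_right_order]. *)
Lemma ker_partMr x h : ker_part (x * h) = zpow a (- psi h)%R * ker_part x * h.
Proof.
rewrite /ker_part psiM; have -> : (- (psi x + psi h) = - psi h - psi x)%R by lia.
by rewrite zpowD !mulgA.
Qed.

(** So [ker_part] is a crossed homomorphism, and the preimage of a normal subgroup under it is a
    subgroup. *)
Lemma ker_partM x y :
  ker_part (x * y) = ker_part x ^ zpow a (psi y) * ker_part y.
Proof. by rewrite ker_partMr conjgE zpowN -!mulgA ker_partK. Qed.

Lemma ker_partV x : ker_part x^-1 = (ker_part x ^ zpow a (psi x^-1))^-1.
Proof. by apply/esym/mulg1_eq; rewrite -ker_partM mulgV ker_part1. Qed.

Lemma tlt_right_order : right_order tlt.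
Proof.
split; last first.
  move=> x y h; rewrite /tlt !ker_partMr !psiM => -[xy|[-> xy]].
    by left; apply: rltMr => //; exact: rltMl.
  by right; split=> //; lia.
split=> [x [/(rltxx ro)//|[_]]|x y z [xy|[xy pxy]] [yz|[yz pyz]]|x y xy].
- by rewrite ltxx.
- by left; exact: (rlt_trans ro xy yz).
- by left; rewrite -yz.
- by left; rewrite xy.
- by right; split; [rewrite xy|lia].
- have [nxy|/(rlt_total ro)[nxy|nxy]] := pselect (ker_part x = ker_part y).
  + have [pxy|pyx|pxy] := ltgtP (psi x) (psi y).
    * by left; right.
    * by right; right.
    * by case: xy; rewrite -(ker_partK x) -(ker_partK y) nxy pxy.
  + by left; left.
  + by right; left.
Qed.

Lemma tlt1a : tlt 1 a.
Proof. by right; rewrite ker_part1 ker_part_a psi1 psia. Qed.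

(** Such an [x] would have kernel component 1, squeezed between those of 1 and [a], and [psi x]
    strictly between 0 and 1. *)
Lemma tlt_discrete_at x : ~ (tlt 1 x /\ tlt x a).
Proof.
rewrite /tlt ker_part1 ker_part_a psi1 psia => -[[x1|[x1 p1]] [x2|[x2 p2]]].
- exact: (rltxx ro (rlt_trans ro x1 x2)).
- by rewrite x2 in x1; exact: (rltxx ro x1).
- by rewrite -x1 in x2; exact: (rltxx ro x2).
- by lia.
Qed.

Lemma tlt_discrete : discrete tlt.
Proof. by exists a; split; [exact: tlt1a|move=> [x]; exact: tlt_discrete_at]. Qed.

Lemma rle_ker_part x y : tlt x y -> rle lt (ker_part x) (ker_part y).
Proof. by case=> [|[->]]; [right|left]. Qed.

Lemma rle_tlt x y : psi x = 0%R -> psi y = 0%R -> rle lt x y -> rle tlt x y.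
Proof.
by move=> px py [->|xy]; [left|right; left; rewrite !ker_part_id].
Qed.

Lemma ker_part_sub E : subgroup E -> E a -> forall x, E (ker_part x) <-> E x.
Proof.
move=> sE Ea x; have [_ EM _] := sE; split=> Ex.
  by rewrite -(ker_partK x); apply: EM => //; exact: subgroup_zpow.
by apply: EM => //; exact: subgroup_zpow.
Qed.

(** A nontrivial subgroup contains an element above 1, and [a] is the least such element. *)
Lemma tlt_convex_a E : convex_subgroups tlt E -> E <> [set 1] -> E a.
Proof.
move=> [sE cE] E1; have [Ee _ _] := sE.
have [x /not_implyP[Ex x1]] : exists x, ~ (E x -> x = 1).
  apply/existsNP => E1'; apply: E1; apply/seteqP; split=> [x /E1'//|x ->//].
have [y [y1 _ Ey]] := subgroup_notin_pos tlt_right_order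
  (convex_subgroups1 tlt_right_order).1 x1.
have ay : rle tlt a y.
  by apply/(rleNlt tlt_right_order) => ya; exact: (@tlt_discrete_at y).
exact: (convexP cE (rltW tlt1a) ay Ee (Ey _ sE Ex)).
Qed.

(** For [E = [set 1]] this is the cyclic subgroup generated by [a]. *)
Definition lift_ker E : set G := [set x | E (ker_part x)].

Lemma lift_ker_convex E : convex_subgroups lt E -> normal_in E setT ->
  convex_subgroups tlt (lift_ker E).
Proof.
move=> [[E1 EM EV] cE] nE; split; last first.
  move=> x y z /rle_ker_part xy /rle_ker_part yz; exact: (convexP cE xy yz).
rewrite /lift_ker; split=> /= [|x y Ex Ey|x Ex].
- by rewrite ker_part1.
- by rewrite ker_partM; apply: EM => //; exact: nE.
- by rewrite ker_partV; apply: EV; exact: nE.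
Qed.

(* [lt] and [tlt] agree on the kernel of [psi]. *)
Lemma convex_hull_ker E x : convex_subgroups tlt E -> psi x = 0%R ->
  convex_hull lt (E `&` [set x | psi x = 0%R]) x -> E x.
Proof.
move=> [sE cE] px [u [v [[Eu /= pu] [Ev /= pv] ux xv]]].
by apply: (convexP cE (rle_tlt pu px ux) (rle_tlt px pv xv)).
Qed.

Lemma ker_subgroup E : subgroup E -> subgroup (E `&` [set x | psi x = 0%R]).
Proof.
move=> [E1 EM EV]; split=> [|x y [Ex /= px] [Ey /= py]|x [Ex /= px]].
- by [].
- by split; [exact: EM|rewrite /= psiM px py].
- by split; [exact: EV|rewrite /= psiV px oppr0].
Qed.

Hypothesis cen : central lt.

Lemma tlt_jump1 K H : jump (convex_subgroups tlt) K H -> K = [set 1] ->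
  H = lift_ker [set 1].
Proof.
move=> [cK cH [sKH nHK] nE] K1.
have cA : convex_subgroups tlt (lift_ker [set 1]).
  apply: lift_ker_convex; first exact: convex_subgroups1.
  by move=> x g -> _; rewrite /= conj1g.
have Ha : H a.
  by apply: (tlt_convex_a cH) => H1; apply: nHK; rewrite H1 K1.
have [sH _] := cH; have [H1 _ _] := sH.
have sAH : lift_ker [set 1] `<=` H.
  by move=> x nx; apply/(ker_part_sub sH Ha); rewrite nx.
apply/seteqP; split=> //; apply: contrapT => nHA; apply: nE.
exists (lift_ker [set 1]); split=> //; rewrite K1; split.
  by move=> x ->; exact: ker_part1.
by move=> /(_ a ker_part_a) /= a1; have := psia; rewrite a1 psi1.
Qed.

(** Take [y] to be the kernel component of an element of [H] outside [K]. The lifts of the jump at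
    [y] lie between [K] and [H] and are separated by [y], so the jump condition forces both
    equalities. *)
Lemma tlt_jump_lift K H : jump (convex_subgroups tlt) K H -> K <> [set 1] ->
  exists y, [/\ y <> 1, K = lift_ker (jump_bottom lt y) &
                H = lift_ker (jump_top lt y)].
Proof.
move=> [cK cH [sKH nHK] nE] K1.
have Ka := tlt_convex_a cK K1; have Ha := sKH _ Ka.
have [sK _] := cK; have [sH _] := cH.
have [x /not_implyP[Hx nKx]] : exists x, ~ (H x -> K x) by apply/existsNP.
pose y := ker_part x; have py : psi y = 0%R by exact: psi_ker_part.
have Hy : H y by apply/(ker_part_sub sH Ha).
have nKy : ~ K y by move=> /(ker_part_sub sK Ka).
have y1 : y <> 1 by move=> e; apply: nKy; rewrite e; case: sK.
have cb := jump_bottom_convex ro y1; have ct := jump_top_convex lt y.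
have ctop := lift_ker_convex ct (central_convex_normal ro cen ct).
have cbot := lift_ker_convex cb (central_convex_normal ro cen cb).
have [_ _ [sbt _] _] := jumpP ro y1.
(* Convex subgroups of [tlt] are compared with those of [lt] through the [lt]-hulls of their
   intersections with the kernel of [psi]. *)
have hull := fun E (sE : subgroup E) => convex_hull_convex bo (ker_subgroup sE).
have in_hull E z : subgroup E -> E a -> E z ->
    convex_hull lt (E `&` [set x | psi x = 0%R]) (ker_part z).
  move=> sE Ea Ez; apply: sub_convex_hull; split; last exact: psi_ker_part.
  exact/(ker_part_sub sE Ea).
have sKbot : K `<=` lift_ker (jump_bottom lt y).
  move=> z Kz; apply: (jump_bottom_sup (hull _ sK)); last exact: in_hull.
  by move=> /(convex_hull_ker cK py).
have stopH : lift_ker (jump_top lt y) `<=` H.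
  move=> z /(jump_top_sub (hull _ sH)) hz; apply/(ker_part_sub sH Ha).
  apply: (convex_hull_ker cH (psi_ker_part z)); apply: hz.
  by rewrite -(ker_part_id py); exact: in_hull.
have sbt' : lift_ker (jump_bottom lt y) `<=` lift_ker (jump_top lt y).
  by move=> z; exact: sbt.
have ytop : lift_ker (jump_top lt y) y.
  by rewrite /lift_ker /= ker_part_id //; exact: jump_top_in.
have nybot : ~ lift_ker (jump_bottom lt y) y.
  by rewrite /lift_ker /= ker_part_id //; exact: jump_bottom_notin.
exists y; split=> //; apply/seteqP; split=> //.
  apply: contrapT => nbK; apply: nE; exists (lift_ker (jump_bottom lt y)).
  split=> //; split; first exact: subset_trans stopH.
  by move=> /(_ _ Hy).
apply: contrapT => ntH; apply: nE; exists (lift_ker (jump_top lt y)).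
split=> //; split; first exact: subset_trans sbt'.
by move=> /(_ _ ytop).
Qed.

Variable R : realType.

Lemma tlt_jump_hoelder K H : jump (convex_subgroups tlt) K H ->
  exists phi : G -> R,
  [/\ forall x y, H x -> H y -> phi (x * y) = (phi x + phi y)%R,
      forall x, H x -> phi x = 0%R <-> K x &
      forall x y, H x -> H y -> (phi x < phi y)%R -> tlt x y].
Proof.
move=> KH; have [K1|K1] := pselect (K = [set 1]).
  (* Here [H] consists of the powers of [a], and [psi] itself is the embedding. *)
  rewrite K1 (tlt_jump1 KH K1); exists (fun x => (psi x)%:~R%R).
  split=> [x y _ _|x /= nx|x y /= nx ny pxy]; first by rewrite psiM intrD.
    split=> [/eqP|->]; last by rewrite psi1.
    by rewrite intr_eq0 => /eqP px; rewrite -(ker_part_id px).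
  by right; rewrite nx ny -(ltr_int R).
have [y [y1 -> ->]] := tlt_jump_lift KH K1.
have jy := jumpP ro y1; have [phi [phiM kerphi phi_lt]] := hoelder bo R jy.
have [cb ct [sbt _] _] := jy; have [st _] := ct; have [_ tM tV] := st.
have nt := central_convex_normal ro cen ct.
(* By centrality the commutator lies in the kernel of [phi]. This removes the conjugation in
   [ker_partM], so [phi \o ker_part] is additive. *)
have phiJ u g : jump_top lt y u -> phi (u ^ g) = phi u.
  move=> tu; have uJ : u ^ g = u * [~ u, g] by rewrite commgEl mulVKg.
  have bJ : jump_bottom lt y [~ u, g].
    by apply: (cen jy) => F [_]; apply; exists u => //; exists g.
  rewrite uJ phiM //; last exact: sbt.
  by rewrite (proj2 (kerphi _ (sbt _ bJ)) bJ) addr0.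
exists (phi \o ker_part); split=> [u v /= tu tv|u /= tu|u v /= tu tv uv].
- by rewrite ker_partM phiM ?phiJ //; exact: nt.
- exact: kerphi.
- by left; exact: phi_lt.
Qed.

Lemma tlt_lexicographic : lexicographic R tlt.
Proof.
have tro := tlt_right_order.
have KHP K H : jump (convex_subgroups tlt) K H ->
    normal_in K H /\ factor_order_isomorphic R tlt H K.
  move=> KH; have [phi [phiM kerphi phi_lt]] := tlt_jump_hoelder KH.
  have [_ [sH _] [sKH _] _] := KH.
  by split; [exact: (real_factor_normal sH phiM kerphi sKH)|
             exact: (real_factor tro sH phiM phi_lt kerphi sKH)].
split=> //; last by move=> K H /KHP[].
split.
- by move=> H [].
- exact: convex_subgroups_total.
- by split; [exact: convex_subgroups1|exact: convex_subgroupsT].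
- move=> F sF F0; split; first exact: convex_subgroups_bigcup.
  exact: convex_subgroups_bigcap.
- by move=> K H /KHP[].
Qed.

End CyclicLexOrder.

(** * Finite generation and the conclusion *)

Lemma finitely_generated_jump_top (G : groupType) (lt : G -> G -> Prop) :
  right_order lt -> nontrivial G -> finitely_generated G ->
  exists2 g, g <> 1 & jump_top lt g = setT.
Proof.
move=> ro [g0 g01] [X [/finite_seqP[s ->] genX]].
(* Convex subgroups form a chain, so the largest of the jump tops of [g0] and of the generators
   contains all generators; starting from [g0] keeps [g] different from 1. *)
suff [g g1 sg] : exists2 g, g <> 1 & forall x, x \in s -> jump_top lt g x.
  exists g => //; apply/seteqP; split=> // x _.
  have : generated [set` s] x by rewrite genX.
  by apply; split=> //; case: (jump_top_convex lt g).
elim: {genX} s => [|y s [g g1 IH]]; first by exists g0.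
have cg := jump_top_convex lt g; have cy := jump_top_convex lt y.
have [gy|yg] := convex_subgroups_total ro cg cy; last first.
  exists g => // x; rewrite inE => /predU1P[->|]; last exact: IH.
  by apply: yg; exact: jump_top_in.
exists y.
  (* The jump top of 1 is trivial, so it can contain [g] only if [g = 1]. *)
  move=> y1; apply: g1; rewrite y1 in gy.
  have := jump_top_sub (convex_subgroups1 ro) (erefl : [set 1 : G] 1).
  by move=> /(_ _ (gy _ (@jump_top_in _ lt g))).
move=> x; rewrite inE => /predU1P[->|xs]; first exact: jump_top_in.
by apply: gy; exact: IH.
Qed.

Lemma finitely_generated_bi_order_int_quotient (R : realType) (G : groupType)
  (lt : G -> G -> Prop) :
  bi_order lt -> nontrivial G -> finitely_generated G ->
  exists (psi : G -> int) (a : G),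
    (forall x y, psi (x * y) = (psi x + psi y)%R) /\ psi a = 1%R.
Proof.
move=> bo Gn Gfg; have [g g1 topT] := finitely_generated_jump_top bo.1 Gn Gfg.
have [phi [phiM kerphi _]] := hoelder bo R (jumpP bo.1 g1).
rewrite topT in phiM kerphi.
apply: (@finitely_generated_int_quotient R G phi g) => //.
  by move=> x y; exact: phiM.
by move=> /(kerphi g I); exact: jump_bottom_notin.
Qed.

Theorem mainTheorem5 (R : realType) (G : groupType)
  (G_nontrivial : nontrivial G) (G_fg : finitely_generated G)
  (G_orderable : exists lt : G -> G -> Prop, bi_order lt) :
  (exists lt : G -> G -> Prop, right_order lt /\ discrete lt) /\
  ((exists lt : G -> G -> Prop, bi_order lt /\ central lt) ->
   exists lt : G -> G -> Prop,
     [/\ right_order lt, discrete lt & lexicographic R lt]).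
Proof.
split=> [|[lt [bo cen]]].
  have [lt bo] := G_orderable.
  have [psi [a [psiM psia]]] :=
    finitely_generated_bi_order_int_quotient R bo G_nontrivial G_fg.
  by exists (tlt lt psi a); split; [exact: tlt_right_order|exact: tlt_discrete].
have [psi [a [psiM psia]]] :=
  finitely_generated_bi_order_int_quotient R bo G_nontrivial G_fg.
exists (tlt lt psi a); split.
- exact: tlt_right_order.
- exact: tlt_discrete.
- exact: tlt_lexicographic.
Qed.
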